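(* If $X$ is an ascent-compatible subset of the hyperoctahedral group $B_n$, and $\mathbb CX$ is given the $H_n^B(0)$-module structure in which $\pi_i(x)=-x$ if $i\in\mathrm{Des}(x)$, $\pi_i(x)=s_ix$ if $i\notin\mathrm{Des}(x)$ and $s_ix\in X$, and $\pi_i(x)=0$ otherwise, then \[\mathrm{ch}^B(\mathbb C X)=\sum_{x\in X}F^B_{\mathrm{Des}(x)}.\]
   Context: $B_n$ is the Coxeter group with simple generators $s_0,\dots,s_{n-1}$, $m(s_0,s_1)=4$, $m(s_i,s_{i+1})=3$ for $1\le i\le n-2$, and $m(s_i,s_j)=2$ otherwise; simple generators are identified with their indices. For $x\in B_n$, $\mathrm{Des}(x)=\{i\in[0,n-1]:\ell(s_ix)<\ell(x)\}$ ($\ell$ = Coxeter length). A quadruple $(u,v,s,t)$ ($u,v\in B_n$, $s,t$ simple generators) is aligned if $\ell(su)>\ell(u)$, $\ell(tv)>\ell(v)$, and $u^{-1}su=v^{-1}tv$; $X$ is ascent-compatible if for all $u,v\in X$ and aligned $(u,v,s,t)$, $su\in X\iff tv\in X$ (for such $X$ the stated operators give an $H_n^B(0)$-action). The type-$B$ $0$-Hecke algebra $H_n^B(0)$ is generated by $\pi_0,\dots,\pi_{n-1}$ with $\pi_i^2=-\pi_i$, $\pi_i\pi_j=\pi_j\pi_i$ for $|i-j|\ge2$, $\pi_i\pi_{i+1}\pi_i=\pi_{i+1}\pi_i\pi_{i+1}$ for $1\le i\le n-2$, and $\pi_0\pi_1\pi_0\pi_1=\pi_1\pi_0\pi_1\pi_0$.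 For $I\subseteq[0,n-1]$, $\mathcal S_I^B=\mathbb C\varepsilon_I$ is the one-dimensional module with $\pi_j\varepsilon_I=-\varepsilon_I$ for $j\in I$ and $\pi_j\varepsilon_I=0$ for $j\notin I$. $F^B_I=\sum x_{i_1}\cdots x_{i_n}$, summed over integers $0=i_0\le i_1\le\cdots\le i_n$ with $i_j<i_{j+1}$ whenever $j\in I$ (variables $x_0,x_1,\dots$). $\mathrm{ch}^B$ is the additive map from the Grothendieck group of finite-dimensional $H_n^B(0)$-modules (with $[A]-[B]+[C]=0$ for short exact sequences $0\to A\to B\to C\to0$) determined by $\mathrm{ch}^B([\mathcal S_I^B])=F^B_I$; $\mathrm{ch}^B(M)$ means $\mathrm{ch}^B([M])$. *)

(* Defs.v *)
From HB Require Import structures.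
From mathcomp Require Import all_boot all_order all_algebra all_fingroup.
From mathcomp Require Import generic_quotient ring_quotient finmap multiset.
From mathcomp Require Import freeg complex.
From mathcomp Require Import boolp classical_sets functions fsbigop reals.

Set Implicit Arguments.
Unset Strict Implicit.
Unset Printing Implicit Defensive.

Import GRing.Theory.
Local Open Scope ring_scope.

Definition coxB (n : nat) (i j : 'I_n) : nat :=
  if i == j then 1%N
  else if (i + j == 1)%N then 4%N
  else if (i.+1 == j) || (j.+1 == i) then 3%N
  else 2%N.

Definition coxB_relations (n : nat) (gT : groupType) (s : 'I_n -> gT) : Prop :=
  forall i j : 'I_n, ((s i * s j) ^+ coxB i j = 1)%g.

(* [gT] is the group presented by the generators [s i] and the Coxeter
   relations of type B_n: it is generated by them, and any family satisfying
   the relations in any group extends to a homomorphism. *)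
Record typeB_system (n : nat) (gT : groupType) (s : 'I_n -> gT) : Prop := {
  typeB_rel : coxB_relations s;
  typeB_gen : forall x : gT, exists w : seq 'I_n, x = (\prod_(i <- w) s i)%g;
  typeB_ext : forall (hT : groupType) (t : 'I_n -> hT), coxB_relations t ->
    exists f : gT -> hT,
      {morph f : x y / (x * y)%g} /\ (forall i : 'I_n, f (s i) = t i)
}.

Section Descents.
Variables (n : nat) (gT : finGroupType) (s : 'I_n -> gT).

Definition has_word (x : gT) (k : nat) : bool :=
  [exists w : k.-tuple 'I_n, x == (\prod_(i <- w) s i)%g].

(* The value is 0 if [x] is not in the submonoid generated by [s], which does
   not happen when [typeB_system s]. *)
Definition cox_length (x : gT) : nat :=
  if pselect (exists k, has_word x k) is left h then ex_minn h else 0%N.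

Definition Des (x : gT) : {set 'I_n} :=
  [set i | (cox_length (s i * x)%g < cox_length x)%N].

Definition aligned (u v : gT) (i j : 'I_n) : Prop :=
  [/\ (cox_length u < cox_length (s i * u)%g)%N,
      (cox_length v < cox_length (s j * v)%g)%N
    & (u^-1 * s i * u = v^-1 * s j * v)%g].

Definition ascent_compatible (X : {set gT}) : Prop :=
  forall u v : gT, u \in X -> v \in X -> forall i j : 'I_n,
    aligned u v i j -> ((s i * u)%g \in X <-> (s j * v)%g \in X).

End Descents.

Section HeckeModules.
Variables (K : fieldType) (n : nat).

(* The algebra being given by generators and relations, a module structure on
   K^d is a family of matrices, acting on column vectors, which satisfies the
   relations. *)
Record hecke_relations (d : nat) (p : 'I_n -> 'M[K]_d) : Prop := {
  hecke_quad : forall i : 'I_n, p i *m p i = - p i;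
  hecke_comm : forall i j : 'I_n, (i.+2 <= j)%N -> p i *m p j = p j *m p i;
  hecke_braid3 : forall i j : 'I_n, (1 <= i)%N -> (j = i.+1 :> nat) ->
    p i *m p j *m p i = p j *m p i *m p j;
  hecke_braid4 : forall i j : 'I_n, (i = 0%N :> nat) -> (j = 1%N :> nat) ->
    p i *m p j *m p i *m p j = p j *m p i *m p j *m p i
}.

Record hmodule : Type := HModule {
  hdim : nat;
  hact : 'I_n -> 'M[K]_hdim;
  hactP : hecke_relations hact
}.

HB.instance Definition _ := gen_eqMixin hmodule.
HB.instance Definition _ := gen_choiceMixin hmodule.

Lemma simple_relations (I : {set 'I_n}) :
  hecke_relations (fun j => if j \in I then - 1%:M else 0 : 'M[K]_1).
Proof.
split=> [i|i j _|i j _ _|i j _ _]; repeat case: ifP => _;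
  by rewrite ?(mulmx0, mul0mx, mulNmx, mulmxN, mulmx1, mul1mx, opprK, oppr0).
Qed.

Definition simple_module (I : {set 'I_n}) : hmodule :=
  HModule (simple_relations I).

Definition hecke_morphism (A B : hmodule) (f : 'M[K]_(hdim B, hdim A)) : Prop :=
  forall i : 'I_n, f *m hact A i = hact B i *m f.

Definition short_exact (A B C : hmodule) : Prop :=
  exists (f : 'M[K]_(hdim B, hdim A)) (g : 'M[K]_(hdim C, hdim B)),
  [/\ hecke_morphism f, hecke_morphism g,
      forall v : 'cV_(hdim A), f *m v = 0 -> v = 0,
      forall w : 'cV_(hdim C), exists v, g *m v = w
    & forall v : 'cV_(hdim B), g *m v = 0 <-> exists u, f *m u = v].

Inductive exact_span : {freeg hmodule} -> Prop :=
| exact_span0 : exact_span 0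
| exact_spanB x y : exact_span x -> exact_span y -> exact_span (x - y)
| exact_span_rel A B C : short_exact A B C ->
    exact_span (<< A >> - << B >> + << C >>).

Definition exact_sub : {pred {freeg hmodule}} := fun x => `[< exact_span x >].

Lemma exact_sub_closed : zmod_closed exact_sub.
Proof.
split=> [|x y /asboolP hx /asboolP hy]; apply/asboolP.
  exact: exact_span0.
exact: exact_spanB.
Qed.

HB.instance Definition _ :=
  GRing.isZmodClosed.Build {freeg hmodule} exact_sub exact_sub_closed.

Definition groth : zmodType := Quotient.quot exact_sub.

Definition groth_class (M : hmodule) : groth := (\pi_groth << M >>)%qT.

End HeckeModules.

(* Formal series with integer coefficients in x_0, x_1, ...; a monomial is the
   multiset of the indices of its variables. *)
Definition fseries : zmodType := {mset nat}%mset -> int.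

(* The sequence i_0, i_1, ..., i_n with i_0 = 0. *)
Definition with_zero (n : nat) (t : n.-tuple nat) (j : nat) : nat :=
  nth 0%N (0%N :: t) j.

Definition FB_index (n : nat) (I : {set 'I_n}) : set (n.-tuple nat) :=
  [set t : n.-tuple nat | forall j : 'I_n,
     (with_zero t j <= with_zero t j.+1)%N /\
     (j \in I -> (with_zero t j < with_zero t j.+1)%N)]%classic.

(* The sum over the infinite index set is taken coefficientwise: each monomial
   [m] comes from at most one [t], its weakly increasing listing. *)
Definition FB (n : nat) (I : {set 'I_n}) : fseries :=
  fun m => \sum_(t \in FB_index I) ((seq_mset t == m)%:R : int).

(* Entry (y, x) is the coefficient of the basis vector y in pi_i(x). *)
Definition ascent_op (K : fieldType) (n : nat) (gT : finGroupType)
    (s : 'I_n -> gT) (X : {set gT}) (i : 'I_n) : 'M[K]_#|X| :=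
  \matrix_(b, a)
    let y := enum_val b in let x := enum_val a in
    if i \in Des s x then - (y == x)%:R
    else if (s i * x)%g \in X then (y == (s i * x)%g)%:R
    else 0.

(* Main.v *)
(* The action of the generators on signed reflections, applied to the letters
   of a word, gives each x a set of inversions M(x), with M(s x) obtained from
   M(x) by toggling the reflection x^-1 s x; hence s is a descent of x iff
   x^-1 s x lies in M(x).  A braid relation is checked on a coset of a rank two
   parabolic subgroup: two chains of ascents lead from its minimal element to
   its maximal one, and they carry the same reflections x^-1 s x in opposite
   orders, so by ascent-compatibility one chain stays in X iff the other does.
   For the characteristic, the elements of X other than a given one x of minimal
   length span a submodule, with quotient the simple module of Des(x). *)
Require Import Defs.
From mathcomp Require Import all_boot all_order all_algebra all_fingroup.
From mathcomp Require Import zify cyclic generic_quotient ring_quotient.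
From mathcomp Require Import complex boolp functions reals.

Set Implicit Arguments.
Unset Strict Implicit.
Unset Printing Implicit Defensive.

Import GRing.Theory.
Local Open Scope ring_scope.

(** * Alternating words in two involutions, and the dihedral group they generate *)

Section AlternatingWords.
Local Open Scope group_scope.
Variable gT : finGroupType.
Implicit Types (a b r : gT) (k : nat).

(** Read from the right, the letters are [a], [b], [a], and so on, in the order in which they act on
    the left of an element. [alt_letter a b k] is the letter that lengthens the word of length
    [k]. *)
Fixpoint alt_word a b k : gT :=
  if k is k'.+1 then alt_word b a k' * a else 1.

Definition alt_letter (I : Type) (i j : I) k : I := if odd k then j else i.

Lemma alt_letterS (I : Type) (i j : I) k :
  alt_letter j i k = alt_letter i j k.+1.
Proof. by rewrite /alt_letter /=; case: odd. Qed.

Lemma alt_wordSr a b k : alt_word a b k.+1 = alt_word b a k * a.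
Proof. by []. Qed.

Lemma alt_wordSl a b k : alt_word a b k.+1 = alt_letter a b k * alt_word a b k.
Proof.
elim: k a b => [|k IHk] a b; first by rewrite /= mulg1 mul1g.
by rewrite -alt_letterS (alt_wordSr a b k.+1) (alt_wordSr a b k) IHk mulgA.
Qed.

Lemma mulg_alt a b k : a * (b * a) ^+ k * b = (a * b) ^+ k.+1.
Proof.
elim: k => [|k IHk]; first by rewrite mulg1 expg1.
by rewrite [RHS]expgS -IHk expgS !mulgA.
Qed.

(** Stripping the rightmost letter exchanges [a] and [b] and conjugates by [a], which turns
    [(b * a) ^+ k * b] into the next power. The resulting reflections are therefore distinct for [k]
    below the order of [a * b]. *)
Lemma alt_word_label a b k : a * a = 1 -> b * b = 1 ->
  (alt_word a b k)^-1 * alt_letter a b k * alt_word a b k = (a * b) ^+ k * a.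
Proof.
elim: k a b => [|k IHk] a b a2 b2; first by rewrite /= invg1 mulg1.
have aV : a^-1 = a by apply/eqP; rewrite eq_invg_mul a2.
transitivity (a * ((b * a) ^+ k * b) * a).
  by rewrite -IHk // -alt_letterS /= invMg aV !mulgA.
by rewrite mulgA mulg_alt.
Qed.

Lemma alt_word_swap a b k : a * a = 1 -> b * b = 1 ->
  (alt_word b a k)^-1 * alt_word a b k = (b * a) ^+ k.
Proof.
elim: k a b => [|k IHk] a b a2 b2; first by rewrite /= invg1 mulg1.
have bV : b^-1 = b by apply/eqP; rewrite eq_invg_mul b2.
transitivity (b * ((alt_word a b k)^-1 * alt_word b a k) * a).
  by rewrite /= invMg bV !mulgA.
by rewrite IHk // mulg_alt.
Qed.

Lemma order_mul_swap a b : a * a = 1 -> b * b = 1 -> #[b * a] = #[a * b].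
Proof.
move=> a2 b2; rewrite -[in RHS]orderV invMg.
have -> : a^-1 = a by apply/eqP; rewrite eq_invg_mul a2.
by have -> : b^-1 = b by apply/eqP; rewrite eq_invg_mul b2.
Qed.

Lemma alt_word_order a b : a * a = 1 -> b * b = 1 ->
  alt_word a b #[a * b] = alt_word b a #[a * b].
Proof.
move=> a2 b2; have := alt_word_swap #[a * b] a2 b2.
rewrite -order_mul_swap // expg_order => /eqP.
by rewrite -eq_mulVg1 => /eqP.
Qed.

Definition alt_words a b h :=
  exists2 k, (k <= #[a * b])%N & (h = alt_word a b k) \/ (h = alt_word b a k).

Lemma alt_wordsC a b h : a * a = 1 -> b * b = 1 ->
  alt_words a b h -> alt_words b a h.
Proof.
move=> a2 b2 [k lek hk]; exists k; first by rewrite order_mul_swap.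
by case: hk; [right | left].
Qed.

(** A factor [a] either cancels the leftmost letter or lengthens the word. When the word already has
    the maximal length, it is first rewritten as the other alternating word, whose leftmost letter
    then cancels. *)
Lemma alt_wordsM a b h : a * a = 1 -> b * b = 1 ->
  alt_words a b h -> alt_words a b (a * h).
Proof.
move=> a2 b2.
have down k c d : c * c = 1 -> d * d = 1 ->
    alt_letter c d k * alt_word c d k.+1 = alt_word c d k.
  move=> c2 d2; rewrite alt_wordSl mulgA /alt_letter.
  by case: odd; rewrite ?c2 ?d2 mul1g.
move=> [[|k] lek hk].
  exists 1%N; first exact: order_gt0.
  by left; case: hk => ->; rewrite /= mulg1 mul1g.
have [ca|ca] := boolP (odd k).
  have [hk'|hk'] := hk.
    have [ltk|] := ltnP k.+1 #[a * b].
      by exists k.+2 => //; left; rewrite [RHS]alt_wordSl /alt_letter /= ca hk'.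
    move=> gek; have ek : k.+1 = #[a * b] by apply/eqP; rewrite eqn_leq lek.
    exists k; first exact: ltnW.
    right; rewrite -(@down k b a) // hk' [in LHS]ek alt_word_order // -ek.
    by rewrite /alt_letter ca.
  exists k; first exact: ltnW.
  by right; rewrite -(@down k b a) // hk' /alt_letter ca.
have [hk'|hk'] := hk.
  exists k; first exact: ltnW.
  by left; rewrite -(@down k a b) // hk' /alt_letter (negPf ca).
have [ltk|] := ltnP k.+1 #[a * b].
  by exists k.+2 => //; right; rewrite [RHS]alt_wordSl /alt_letter /= ca hk'.
move=> gek; have ek : k.+1 = #[a * b] by apply/eqP; rewrite eqn_leq lek.
exists k; first exact: ltnW.
left; rewrite -(@down k a b) // hk' [in LHS]ek -alt_word_order // -ek.
by rewrite /alt_letter (negPf ca).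
Qed.

Lemma gen_alt_words a b h : a * a = 1 -> b * b = 1 ->
  h \in <<[set a; b]>> -> alt_words a b h.
Proof.
move=> a2 b2 /gen_prodgP[N [c cP ->]].
elim: N c cP => [|N IHN] c cP.
  by rewrite big_ord0; exists 0%N => //; left.
rewrite big_ord_recl.
have IH := IHN (fun i => c (lift ord0 i)) (fun i => cP (lift ord0 i)).
have := cP ord0; rewrite !inE => /orP[]/eqP->; first exact: alt_wordsM.
by apply: alt_wordsC => //; apply: alt_wordsM => //; apply: alt_wordsC.
Qed.

End AlternatingWords.

(** * The signed conjugation action and its Coxeter relations *)

Section SignedReflections.
Local Open Scope group_scope.
Variable gT : finGroupType.
Implicit Types (a b r : gT) (k : nat) (z : gT * bool).

(** This models a simple reflection acting on roots: the sign changes only at its own root. *)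
Definition signed_conj a z : gT * bool := (z.1 ^ a, z.2 (+) (z.1 == a)).

Lemma conjg_eq_self a r : (r ^ a == a) = (r == a).
Proof. have aa : a ^ a = a by rewrite conjgE mulKg.
by rewrite -{2}aa (inj_eq (conjg_inj a)). Qed.

Lemma signed_conj_invol a : a * a = 1 -> involutive (signed_conj a).
Proof.
move=> a2 [r e]; rewrite /signed_conj /= -conjgM a2 conjg1.
by rewrite conjg_eq_self -addbA addbb addbF.
Qed.

Definition signed_perm a (a2 : a * a = 1) : {perm gT * bool} :=
  perm (inv_inj (signed_conj_invol a2)).

Lemma signed_permE a (a2 : a * a = 1) z : signed_perm a2 z = signed_conj a z.
Proof. exact: permE. Qed.

Lemma mulg_sandwich a b k : a * a = 1 -> b * b = 1 ->
  (a * b) ^+ k * a * (a * b) ^+ k = a.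
Proof.
move=> a2 b2; elim: k => [|k IHk]; first by rewrite mulg1 mul1g.
rewrite {1}expgS expgSr.
transitivity (a * b * ((a * b) ^+ k * a * (a * b) ^+ k) * (a * b)).
  by rewrite !mulgA.
by rewrite IHk -!mulgA (mulgA a a) a2 mul1g b2 mulg1.
Qed.

Lemma conjg_eq_inv r (x y : gT) : (r ^ x == y) = (r == x * y * x^-1).
Proof. by rewrite -(inj_eq (conjg_inj x^-1)) conjgK conjgE invgK mulgA. Qed.

(* The sign changes once for each occurrence of [r] in the sequence of
   reflections attached to the word [(a b)^k]. *)
Lemma signed_perm_expg a b (a2 : a * a = 1) (b2 : b * b = 1) k r (e : bool) :
  ((signed_perm a2 * signed_perm b2) ^+ k) (r, e) =
  (r ^ ((a * b) ^+ k),
   e (+) \big[addb/false]_(l < k.*2) (r == (a * b) ^+ l * a)).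
Proof.
elim: k => [|k IHk]; first by rewrite perm1 conjg1 big_ord0 addbF.
rewrite expgSr !permM IHk !signed_permE /signed_conj /=.
rewrite -!conjgM expgSr !mulgA doubleS !big_ord_recr /= !addbA.
congr (_, _ (+) _ (+) _).
  rewrite conjg_eq_inv; congr (_ == _); apply: (mulIg ((a * b) ^+ k)).
  rewrite mulgKV -addnn expgD -!mulgA; congr (_ * _).
  by rewrite mulgA mulg_sandwich.
rewrite conjg_eq_inv; congr (_ == _); apply: (mulIg ((a * b) ^+ k * a)).
rewrite mulgKV -addnn expgSr expgD.
transitivity ((a * b) ^+ k * (a * b) * ((a * b) ^+ k * a * (a * b) ^+ k) * a).
  by rewrite mulg_sandwich // -!mulgA a2 mulg1.
have gC : (a * b) ^+ k * (a * b) = a * b * (a * b) ^+ k by rewrite -expgSr expgS.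
by rewrite -[_ ^+ k * _ ^+ k * _]mulgA [in RHS]gC !mulgA.
Qed.

(** The sign is a parity over [m.*2] positions. Positions [l] and [l + m] carry the same reflection
    because [(a * b) ^+ m = 1], so the contributions cancel in pairs. *)
Lemma signed_perm_relation a b (a2 : a * a = 1) (b2 : b * b = 1) m :
  (a * b) ^+ m = 1 -> (signed_perm a2 * signed_perm b2) ^+ m = 1.
Proof.
move=> abm; apply/permP=> -[r e].
rewrite signed_perm_expg perm1 abm conjg1; congr (_, _).
rewrite -addnn big_split_ord /= -big_split /= big1 ?addbF // => i _.
by rewrite expgD abm mul1g addbb.
Qed.

End SignedReflections.

(** * Inversion sets, exchange and descents *)

Section Length.
Local Open Scope group_scope.
Variables (n : nat) (gT : finGroupType) (s : 'I_n -> gT).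
Hypothesis sB : typeB_system s.
Implicit Types (x y u r : gT) (i j : 'I_n).

Lemma has_wordP x k :
  reflect (exists2 w, size w = k & x = \prod_(i <- w) s i) (has_word s x k).
Proof.
apply: (iffP existsP) => [[w /eqP->]|[w wk ->]].
  by exists w; rewrite ?size_tuple.
have wk' : size w == k by rewrite wk.
by exists (Tuple wk').
Qed.

Lemma cox_length_word x :
  exists2 w, size w = cox_length s x & x = \prod_(i <- w) s i.
Proof.
rewrite /cox_length; case: pselect => [h|h].
  by case: ex_minnP => k /has_wordP.
case: h; have [w ->] := typeB_gen sB x.
by exists (size w); apply/has_wordP; exists w.
Qed.

Lemma cox_length_prod w : (cox_length s (\prod_(i <- w) s i) <= size w)%N.
Proof.
rewrite /cox_length; case: pselect => [h|//].
by case: ex_minnP => k _; apply; apply/has_wordP; exists w.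
Qed.

Lemma gen_sq i : s i * s i = 1.
Proof. by have := typeB_rel sB i i; rewrite /coxB eqxx. Qed.

Lemma gen_ind (P : gT -> Prop) :
  P 1 -> (forall i x, P x -> P (s i * x)) -> forall x, P x.
Proof.
move=> P1 Ps x; have [w ->] := typeB_gen sB x.
by elim: w => [|i w IHw]; rewrite ?big_nil // big_cons; apply: Ps.
Qed.

(** The universal property of the presentation extends the signed permutations to a morphism [f];
    inversions are read off from the signs that [f x] changes. *)
Lemma inversion_sets : exists M : gT -> {set gT},
  M 1 = set0 /\
  forall i x r, (r \in M (s i * x)) = (r \in M x) (+) (r == x^-1 * s i * x).
Proof.
have [|f [fM fs]] := typeB_ext sB (t := fun i => signed_perm (gen_sq i)).
  by move=> i j; apply: signed_perm_relation; apply: (typeB_rel sB).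
have f1 : f 1 = 1 by apply: (mulgI (f 1)); rewrite -fM !mulg1.
have flip x r e : (f x (r, e)).2 = (f x (r, false)).2 (+) e.
  elim/gen_ind: x r e => [|i x IHx] r e; first by rewrite f1 !perm1.
  rewrite fM fs !permM !signed_permE /signed_conj /= IHx [in RHS]IHx.
  by case: e (_ == _) (_.2) => [] [] [].
(* Since [f x] conjugates by [x], starting at [r ^ x^-1] makes [r] the end point. A letter added on
   the left then affects only the first move. *)
exists (fun x => [set r | (f x (r ^ x^-1, false)).2]); split.
  by apply/setP=> r; rewrite !inE f1 perm1.
move=> i x r; rewrite !inE fM permM fs signed_permE /signed_conj /= flip.
rewrite invMg conjgM -(conjgM _ _ (s i)) mulVg conjg1; congr (_ (+) _).
by rewrite -conjgM conjg_eq_inv invMg !invgK !mulgA mulgKV.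
Qed.

Section Inversions.
Variable M : gT -> {set gT}.
Hypothesis M1 : M 1 = set0.
Hypothesis MS : forall i x r,
  (r \in M (s i * x)) = (r \in M x) (+) (r == x^-1 * s i * x).

(* Strong exchange: multiplying by an inversion deletes a letter. *)
Lemma inversion_shortens x r :
  r \in M x -> (cox_length s (x * r) < cox_length s x)%N.
Proof.
have [w <- ->] := cox_length_word x.
move=> rM; suff [w' lt_w ->] : exists2 w', (size w' < size w)%N &
    (\prod_(i <- w) s i) * r = \prod_(i <- w') s i.
  exact: leq_ltn_trans (cox_length_prod w') lt_w.
elim: w rM => [|i w IHw]; first by rewrite big_nil M1 inE.
rewrite big_cons MS; case: (boolP (r \in _)) => [rM _|_ /eqP->].
  have [w' lt_w eq_w] := IHw rM; exists (i :: w') => //.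
  by rewrite -mulgA eq_w big_cons.
by exists w => //; rewrite !mulgA mulgK gen_sq mul1g.
Qed.

Lemma gen_label i x : s i * x = x * (x^-1 * s i * x).
Proof. by rewrite !mulgA mulgV mul1g. Qed.

(** The elements [x] and [s i * x] have the same label, which the toggling rule puts into
    [M (s i * x)]. Exchange applied to [s i * x] leads back to [x] and shortens. *)
Lemma gen_ascends i x : x^-1 * s i * x \notin M x ->
  (cox_length s x < cox_length s (s i * x))%N.
Proof.
move=> /negPf rM.
rewrite -[X in (cox_length s X < _)%N]mul1g -(gen_sq i) -mulgA.
rewrite (gen_label i (s i * x)).
apply: inversion_shortens.
suff -> : (s i * x)^-1 * s i * (s i * x) = x^-1 * s i * x by rewrite MS rM eqxx.
by rewrite invMg !mulgA mulgKV.
Qed.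

Lemma Des_inversion i x : (i \in Des s x) = (x^-1 * s i * x \in M x).
Proof.
rewrite inE; apply/idP/idP => [|rM]; last by rewrite gen_label inversion_shortens.
by apply: contraTT => rM; rewrite -leqNgt ltnW // gen_ascends.
Qed.

Lemma Des_ascent i x : i \notin Des s x ->
  (cox_length s x < cox_length s (s i * x))%N.
Proof. by rewrite Des_inversion; apply: gen_ascends. Qed.

End Inversions.

End Length.

(** * The two chains of ascents in a coset of a rank two parabolic subgroup *)

Section Chains.
Local Open Scope group_scope.
Variables (n : nat) (gT : finGroupType) (s : 'I_n -> gT).
Hypothesis sB : typeB_system s.
Implicit Types (x u r : gT) (i j : 'I_n).

(** Since [b * a] is inverse to [a * b], both sides times [a] differ by a full turn. Thus step [k]
    of one chain has the reflection of step [m] of the other when [k + m + 1] is the order. *)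
Lemma alt_word_rev (a b : gT) k m : a * a = 1 -> b * b = 1 ->
  (k + m).+1 = #[a * b] -> (b * a) ^+ k * b = (a * b) ^+ m * a.
Proof.
move=> a2 b2 km; apply: (mulIg a).
rewrite -[RHS]mulgA a2 mulg1 -[LHS]mulgA -expgSr.
have -> : b * a = (a * b)^-1.
  by rewrite invMg; congr (_ * _); apply/eqP; rewrite eq_sym eq_invg_mul ?a2 ?b2.
by apply/eqP; rewrite expVgn eq_invg_mul -expgD addSn km expg_order.
Qed.

Definition chain u i j k := alt_word (s i) (s j) k * u.

Lemma chainS u i j k : chain u i j k.+1 = s (alt_letter i j k) * chain u i j k.
Proof.
by rewrite /chain alt_wordSl -mulgA /alt_letter; case: odd.
Qed.

Lemma chain_label u i j k :
  (chain u i j k)^-1 * s (alt_letter i j k) * chain u i j k =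
  u^-1 * ((s i * s j) ^+ k * s i) * u.
Proof.
rewrite -(alt_word_label k (gen_sq sB i) (gen_sq sB j)) /chain invMg !mulgA.
by rewrite /alt_letter; case: odd.
Qed.

Definition coset_min u i j := forall h, h \in <<[set s i; s j]>> ->
  (cox_length s u <= cox_length s (h * u))%N.

Lemma coset_minC u i j : coset_min u i j -> coset_min u j i.
Proof. by move=> umin h; rewrite setUC => /umin. Qed.

Lemma exists_coset_min x i j : exists u h,
  [/\ coset_min u i j, h \in <<[set s i; s j]>> & x = h * u].
Proof.
pose D := <<[set s i; s j]>>.
case: (@arg_minnP _ 1 (mem D) (fun h => cox_length s (h * x)) (group1 _)).
move=> h hD hmin; exists (h * x), h^-1; split; last by rewrite mulKg.
  by move=> h' h'D; rewrite mulgA; apply: hmin; apply: groupM.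
by rewrite groupV.
Qed.

Section ChainFromMin.
Variables (u : gT) (i j : 'I_n).
Hypothesis umin : coset_min u i j.
Let d := #[s i * s j].

(** The label of step [k] is not an inversion of [u], since exchange would give a shorter element of
    the coset. Each earlier step toggles a different label, so it is still absent at level [k]. *)
Lemma chain_ascent k : (k < d)%N -> alt_letter i j k \notin Des s (chain u i j k).
Proof.
have [M [M1 MS]] := inversion_sets sB.
move=> kd; rewrite (Des_inversion sB M1 MS) chain_label.
suff: forall l, (l <= k)%N ->
    u^-1 * ((s i * s j) ^+ k * s i) * u \notin M (chain u i j l) by apply.
elim=> [_|l IHl lk].
  rewrite /chain mul1g; apply/negP => /(inversion_shortens sB M1 MS).
  rewrite !mulgA mulgV mul1g ltnNge umin //.
  by rewrite groupM ?groupX ?groupM // mem_gen // !inE eqxx ?orbT.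
rewrite chainS MS (negPf (IHl (ltnW lk))) addFb chain_label.
rewrite (inj_eq (mulIg u)) (inj_eq (mulgI _)) (inj_eq (mulIg _)).
rewrite eq_expg_mod_order !modn_small ?neq_ltn ?lk ?orbT //.
exact: ltn_trans lk kd.
Qed.

Lemma chain_descent k :
  (k < d)%N -> alt_letter i j k \in Des s (chain u i j k.+1).
Proof.
move=> kd; have [M [M1 MS]] := inversion_sets sB.
rewrite inE {1}chainS mulgA gen_sq // mul1g chainS.
exact: (Des_ascent sB M1 MS (chain_ascent kd)).
Qed.

End ChainFromMin.

Lemma chain_end u i j :
  chain u i j #[s i * s j] = chain u j i #[s i * s j].
Proof. by rewrite /chain alt_word_order // gen_sq. Qed.

(* The two chains of the coset carry the same reflections in opposite order,
   so compatibility transfers membership from one chain to the other. *)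
Lemma chain_compatible (X : {set gT}) u i j :
  ascent_compatible s X -> coset_min u i j ->
  (forall k, (k <= #[s i * s j])%N -> chain u i j k \in X) ->
  forall k, (k <= #[s i * s j])%N -> chain u j i k \in X.
Proof.
move=> acX umin pX; have [M [M1 MS]] := inversion_sets sB.
have dC : #[s j * s i] = #[s i * s j] by rewrite order_mul_swap // gen_sq.
elim=> [|k IHk] kd; first exact: (pX 0%N).
have kd' : (#[s i * s j] - k.+1 < #[s i * s j])%N.
  by rewrite ltn_subrL order_gt0.
rewrite chainS; apply/(acX (chain u i j (#[s i * s j] - k.+1))).
- exact/pX/ltnW.
- exact/IHk/ltnW.
- split; first exact: (Des_ascent sB M1 MS (chain_ascent umin kd')).
    apply: (Des_ascent sB M1 MS (chain_ascent (coset_minC umin) _)).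
    by rewrite dC.
  rewrite !chain_label; congr (_ * _ * _); apply/esym.
  by apply: alt_word_rev; rewrite ?gen_sq // -addSn subnKC.
by rewrite -chainS; apply: pX.
Qed.

End Chains.

(** * Ascent operators on basis vectors, and alternating matrix products *)

Section AscentOperators.
Variables (K : fieldType) (n : nat) (gT : finGroupType) (s : 'I_n -> gT).
Variable X : {set gT}.

(** This is zero for [x] outside [X], so that the two ascent cases of the action become one
    formula. *)
Definition basis_vec (x : gT) : 'cV[K]_#|X| :=
  \col_b (enum_val b == x)%:R.

Lemma basis_vec_notin x : x \notin X -> basis_vec x = 0.
Proof.
move=> xX; apply/colP=> b; rewrite !mxE; case: eqP => // bx.
by rewrite -bx enum_valP in xX.
Qed.

Lemma basis_vecE a : basis_vec (enum_val a) = delta_mx a 0.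
Proof. by apply/colP=> b; rewrite !mxE (inj_eq enum_val_inj) andbT. Qed.

Lemma eq_basis_mx m (A B : 'M[K]_(m, #|X|)) :
  (forall x, x \in X -> A *m basis_vec x = B *m basis_vec x) -> A = B.
Proof.
move=> AB; apply/matrixP=> r a.
have /colP/(_ r) := AB _ (enum_valP a).
by rewrite basis_vecE -!colE !mxE.
Qed.

Lemma ascent_op_vec i x : x \in X ->
  ascent_op K s X i *m basis_vec x =
  if i \in Des s x then - basis_vec x else basis_vec (s i * x)%g.
Proof.
move=> xX; have xE : basis_vec x = delta_mx (enum_rank_in xX x) 0.
  by rewrite -basis_vecE enum_rankK_in.
rewrite {1}xE -colE; apply/colP=> b; rewrite !mxE /= enum_rankK_in //.
case: ifP => _; first by rewrite !mxE.
case: ifP => [_|/negbT sX]; first by rewrite mxE.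
by rewrite basis_vec_notin // mxE.
Qed.

End AscentOperators.

Section AlternatingProducts.
Variables (R : comNzRingType) (N : nat).
Implicit Types (A B : 'M[R]_N).

Fixpoint alt_mx A B k : 'M[R]_N :=
  if k is k'.+1 then alt_mx B A k' *m A else 1%:M.

Lemma alt_mxD A B k m :
  alt_mx A B (k + m) =
  alt_mx (alt_letter A B m) (alt_letter B A m) k *m alt_mx A B m.
Proof.
elim: m A B => [|m IHm] A B; first by rewrite addn0 mulmx1.
by rewrite addnS /= IHm -mulmxA -!alt_letterS.
Qed.

Lemma alt_mx_neg A B k (v : 'cV_N) : A *m v = - v -> B *m v = - v ->
  alt_mx A B k *m v = (-1) ^+ k *: v.
Proof.
elim: k A B => [|k IHk] A B Av Bv; first by rewrite mul1mx scale1r.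
by rewrite /= -mulmxA Av mulmxN IHk // exprS mulN1r scaleNr.
Qed.

(** The product is cut into blocks of length [d], exchanged one by one. This passes from the order
    of [s i * s j] to its multiple [coxB i j]. *)
Lemma alt_mx_dvdn A B d m : (d %| m)%N ->
  alt_mx A B d = alt_mx B A d -> alt_mx A B m = alt_mx B A m.
Proof.
move=> /dvdnP[c ->] ABd; elim: c => [//|c IHc].
rewrite mulSn !alt_mxD IHc; congr (_ *m _).
by rewrite /alt_letter; case: odd.
Qed.

End AlternatingProducts.

(** * Braid and quadratic relations for the ascent operators *)

Section AscentModule.
Variables (K : fieldType) (n : nat) (gT : finGroupType) (s : 'I_n -> gT).
Hypothesis sB : typeB_system s.
Variable X : {set gT}.
Hypothesis acX : ascent_compatible s X.
Implicit Types (x u : gT) (i j : 'I_n).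

Local Notation T := (ascent_op K s X).
Local Notation e := (basis_vec K X).

(** Each factor meets an ascent and moves one level up; the first exit from [X] gives zero, which
    later factors preserve. *)
Lemma chain_climb u i j k l : coset_min s u i j ->
  (k + l <= #[s i * s j]%g)%N -> chain s u i j k \in X ->
  alt_mx (T (alt_letter i j k)) (T (alt_letter j i k)) l *m e (chain s u i j k)
  = if all (fun m => chain s u i j m \in X) (iota k.+1 l)
    then e (chain s u i j (k + l)) else 0.
Proof.
move=> umin; elim: l k => [|l IHl] k kl pX /=; first by rewrite mul1mx addn0.
have kd : (k < #[s i * s j]%g)%N by rewrite (leq_trans _ kl) // -addSnnS leq_addr.
rewrite -mulmxA ascent_op_vec // (negPf (chain_ascent sB umin kd)) -chainS.
have [pSX|/basis_vec_notin->] := boolP (_ \in X); last by rewrite mulmx0.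
by rewrite (alt_letterS i j k) (alt_letterS j i k) IHl // addSnnS.
Qed.

(** From the bottom, the two products climb the two chains to a common top. From a higher level,
    both climb the rest of the same chain and differ only in when the signs from descents occur. *)
Lemma chain_braid u i j k : coset_min s u i j ->
  (k <= #[s i * s j]%g)%N -> chain s u i j k \in X ->
  alt_mx (T i) (T j) #[s i * s j]%g *m e (chain s u i j k) =
  alt_mx (T j) (T i) #[s i * s j]%g *m e (chain s u i j k).
Proof.
move=> umin; set d := #[_]%g => kd pX.
have d_gt0 : (0 < d)%N by exact: order_gt0.
have dC : #[s j * s i]%g = d by rewrite order_mul_swap // gen_sq.
(* The last steps of the two chains reach the same element by different generators, so both are
   descents there. *)
have top : forall c, c = i \/ c = j ->
    T c *m e (chain s u i j d) = - e (chain s u i j d).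
  move=> c cij; have [dX|/basis_vec_notin->] := boolP (chain s u i j d \in X);
    last by rewrite mulmx0 oppr0.
  suff cD : c \in Des s (chain s u i j d) by rewrite ascent_op_vec // cD.
  have dp : (d.-1 < d)%N by rewrite prednK.
  have := chain_descent sB umin dp.
  have dp' : (d.-1 < #[s j * s i]%g)%N by rewrite dC.
  have := chain_descent sB (coset_minC umin) dp'.
  rewrite prednK // -(chain_end sB) -/d /alt_letter.
  by case: cij => ->; case: odd.
case: k kd pX => [|k] kd pX.
  have climb := @chain_climb u i j 0 d umin (leqnn d) pX.
  have climb' := @chain_climb u j i 0 d (coset_minC umin).
  rewrite dC leqnn in climb'.
  rewrite [LHS]climb [RHS](climb' isT pX) -(chain_end sB) -/d.
  suff -> : all (fun m => chain s u i j m \in X) (iota 1 d) =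
            all (fun m => chain s u j i m \in X) (iota 1 d) by [].
  have allP' a b : all (fun m => chain s u a b m \in X) (iota 1 d) ->
      forall m, (m <= d)%N -> chain s u a b m \in X.
    move=> /allP h [|m] md; first exact: pX.
    by apply: h; rewrite mem_iota.
  apply/idP/idP => /allP' h;
    apply/allP => m; rewrite mem_iota ltnS => /andP[_ md].
    exact: (chain_compatible sB acX umin h).
  by apply: (chain_compatible sB acX (coset_minC umin)); rewrite dC.
(* Here [a] continues the climb, while [b] is the letter by which this level was reached, hence a
   descent. Starting with [a] costs [k.+1] signs after the climb; starting with [b] costs one sign
   before it and [k] after. *)
set a := alt_letter i j k.+1; set b := alt_letter j i k.+1.
have aij : a = i \/ a = j by rewrite /a /alt_letter; case: odd; [right|left].
have bij : b = i \/ b = j by rewrite /b /alt_letter; case: odd; [left|right].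
have bdesc : T b *m e (chain s u i j k.+1) = - e (chain s u i j k.+1).
  have -> : b = alt_letter i j k by rewrite /b /alt_letter /=; case: odd.
  by rewrite ascent_op_vec // (chain_descent sB umin kd).
suff : alt_mx (T a) (T b) d *m e (chain s u i j k.+1) =
       alt_mx (T b) (T a) d *m e (chain s u i j k.+1).
  by rewrite /a /b /alt_letter; case: odd.
have dk : d = (k.+1 + (d - k.+1))%N by rewrite subnKC.
rewrite [X in alt_mx (T b) (T a) X]dk addSn [alt_mx (T b) _ _]/= -mulmxA bdesc.
rewrite [X in alt_mx (T a) (T b) X]dk !alt_mxD mulmxN.
rewrite -[LHS]mulmxA -[in RHS]mulmxA.
have yE := @chain_climb u i j k.+1 (d - k.+1) umin.
rewrite subnKC // leqnn in yE; rewrite (yE isT pX) => {yE}.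
set y := if _ then _ else _.
have yN c : c = i \/ c = j -> T c *m y = - y.
  by move=> cij; rewrite /y; case: ifP => _; [exact: top | rewrite mulmx0 oppr0].
have altN q m : alt_mx (alt_letter (T a) (T b) q) (alt_letter (T b) (T a) q) m
    *m y = (-1) ^+ m *: y.
  by apply: alt_mx_neg; rewrite /alt_letter; case: odd; apply: yN.
by rewrite !altN exprS mulN1r scaleNr.
Qed.

(** Every basis element lies on one of the two chains above the minimal element of its coset, so the
    check reduces to chains. *)
Lemma ascent_op_braid i j :
  alt_mx (T i) (T j) #[s i * s j]%g = alt_mx (T j) (T i) #[s i * s j]%g.
Proof.
apply: (@eq_basis_mx _ _ X) => x xX.
have [u [h [umin hD xE]]] := exists_coset_min s x i j.
have [k kd [hE|hE]] := gen_alt_words (gen_sq sB i) (gen_sq sB j) hD.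
  by move: xX; rewrite xE hE; apply: chain_braid.
have dC : #[s j * s i]%g = #[s i * s j]%g by rewrite order_mul_swap // gen_sq.
move: xX; rewrite xE hE -dC => xX; apply/esym.
by apply: chain_braid => //; [exact: coset_minC | rewrite dC].
Qed.

Lemma ascent_op_coxB i j m : coxB i j = m ->
  alt_mx (T i) (T j) m = alt_mx (T j) (T i) m.
Proof.
move=> <-; apply: alt_mx_dvdn (ascent_op_braid i j).
by rewrite order_dvdn (typeB_rel sB).
Qed.

Lemma ascent_op_relations : hecke_relations T.
Proof.
have [M [M1 MS]] := inversion_sets sB.
split=> [i|i j ij|i j i1 ij|i j i0 j1].
- apply: (@eq_basis_mx _ _ X) => x xX; rewrite -mulmxA mulNmx ascent_op_vec //.
  case: ifPn => [iD|iA]; first by rewrite mulmxN ascent_op_vec // iD.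
  have [sX|/basis_vec_notin->] := boolP ((s i * x)%g \in X); last first.
    by rewrite mulmx0 oppr0.
  rewrite ascent_op_vec // ifT // inE mulgA gen_sq // mul1g.
  exact: (Des_ascent sB M1 MS iA).
- have := @ascent_op_coxB j i 2; rewrite /= !mul1mx; apply.
  rewrite /coxB; case: eqVneq => [ji|_]; first by rewrite ji ltnNge leqnSn in ij.
  do 2?[case: ifP => //]; lia.
- have := @ascent_op_coxB i j 3; rewrite /= !mul1mx; apply.
  rewrite /coxB -val_eqE /= ij; case: eqP; first lia.
  by do 2?[case: ifP => //]; lia.
- have := @ascent_op_coxB j i 4; rewrite /= !mul1mx ; apply.
  by rewrite /coxB -val_eqE /= i0 j1.
Qed.

End AscentModule.

(** * Classes in the Grothendieck group *)

Section ClassOfAscentModule.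
Variables (K : fieldType) (n : nat).

Lemma groth_class_exact (A B C : hmodule K n) : short_exact A B C ->
  groth_class B = groth_class A + groth_class C.
Proof.
move=> ABC; have : groth_class A - groth_class B + groth_class C = 0.
  rewrite /groth_class -raddfB -raddfD; apply/eqP.
  rewrite -(raddf0 \pi_(groth K n)%qT) -Quotient.idealrBE subr0.
  by apply/asboolP; apply: exact_span_rel.
by move=> /eqP; rewrite addrAC subr_eq0 => /eqP.
Qed.

(** With zero maps, [B], [B], [B] form a short exact sequence, so the class equals its own
    double. *)
Lemma groth_class_dim0 (B : hmodule K n) : hdim B = 0%N -> groth_class B = 0.
Proof.
move=> B0; have z (v : 'cV[K]_(hdim B)) : v = 0.
  by apply/colP=> i; have := ltn_ord i; rewrite {2}B0.
suff /groth_class_exact : short_exact B B B.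
  by move/esym/(canRL (addrK _)); rewrite subrr.
exists 0, 0; split=> [i|i|v _|w|v].
- by rewrite mul0mx mulmx0.
- by rewrite mul0mx mulmx0.
- exact: z.
- by exists 0; rewrite [LHS]z [RHS]z.
- by split=> _; [exists 0; rewrite [LHS]z [RHS]z | exact: z].
Qed.

(** An intertwiner with a left inverse is injective, so relations descend to a submodule. The
    induction on [X] uses this to obtain the module structure on a smaller set. *)
Lemma hecke_relations_sub d d' (p : 'I_n -> 'M[K]_d) (q : 'I_n -> 'M[K]_d')
    (f : 'M[K]_(d', d)) (f' : 'M[K]_(d, d')) :
  f' *m f = 1%:M -> (forall i, f *m p i = q i *m f) ->
  hecke_relations q -> hecke_relations p.
Proof.
move=> f'f fpq q_rel.
have f_inj (A B : 'M_d) : f *m A = f *m B -> A = B.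
  by move=> /(congr1 (mulmx f')); rewrite !mulmxA f'f !mul1mx.
have fM A A' B B' : f *m A = A' *m f -> f *m B = B' *m f ->
    f *m (A *m B) = (A' *m B') *m f.
  by move=> fA fB; rewrite mulmxA fA -mulmxA fB mulmxA.
have fM2 i j : f *m (p i *m p j) = q i *m q j *m f by apply: fM.
have fM3 i j k : f *m (p i *m p j *m p k) = q i *m q j *m q k *m f by apply: fM.
have fM4 i j k l :
    f *m (p i *m p j *m p k *m p l) = q i *m q j *m q k *m q l *m f by apply: fM.
split=> [i|i j ij|i j i1 ij|i j i0 j1]; apply: f_inj.
- by rewrite fM2 mulmxN fpq -mulNmx (hecke_quad q_rel).
- by rewrite !fM2 (hecke_comm q_rel ij).
- by rewrite !fM3 (hecke_braid3 q_rel i1 ij).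
- by rewrite !fM4 (hecke_braid4 q_rel i0 j1).
Qed.

Variables (gT : finGroupType) (s : 'I_n -> gT).
Hypothesis sB : typeB_system s.

(* Removing an element of minimal length leaves a set closed under ascents,
   hence a submodule. *)
Lemma groth_class_ascent (X : {set gT})
    (opX : hecke_relations (ascent_op K s X)) :
  groth_class (HModule opX) =
  \sum_(x in X) groth_class (simple_module K (Des s x)).
Proof.
have [M [M1 MS]] := inversion_sets sB.
elim: {X}#|X| {-2}X (erefl #|X|) opX => [|N IHN] X cX opX.
  rewrite groth_class_dim0 // big_pred0 // => x.
  by rewrite (cards0_eq cX) inE.
have [x0 x0X] : exists x, x \in X by apply/card_gt0P; rewrite cX.
case: (@arg_minnP _ x0 (mem X) (cox_length s) x0X) => x /= xX xmin {x0 x0X}.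
have {}xX : x \in X by [].
pose Y := X :\ x.
have YX y : y \in Y -> y \in X by rewrite inE => /andP[].
pose f : 'M[K]_(#|X|, #|Y|) := \matrix_(b, a) (enum_val b == enum_val a)%:R.
pose g : 'M[K]_(1, #|X|) := \row_a (enum_val a == x)%:R.
have fE y : y \in Y -> f *m basis_vec K Y y = basis_vec K X y.
  move=> yY; rewrite -(enum_rankK_in yY yY) basis_vecE -colE.
  by apply/colP=> b; rewrite !mxE.
have gE y : y \in X -> g *m basis_vec K X y = (y == x)%:R%:M.
  move=> yX; rewrite -(enum_rankK_in yX yX) basis_vecE -colE.
  by apply/colP=> b; rewrite !mxE (ord1 b) eqxx.
have up i y : i \notin Des s y -> y \in X -> (s i * y)%g != x.
  move=> iA yX; apply/eqP=> yx.
  by have := Des_ascent sB M1 MS iA; rewrite yx ltnNge xmin.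
have fT i : f *m ascent_op K s Y i = ascent_op K s X i *m f.
  apply: (@eq_basis_mx _ _ Y) => y yY; rewrite -!mulmxA fE //.
  rewrite !ascent_op_vec ?YX //; case: ifPn => [_|iA].
    by rewrite mulmxN fE.
  have [sX|sX] := boolP ((s i * y)%g \in X).
    by rewrite fE // inE sX andbT inE up // YX.
  rewrite !basis_vec_notin ?mulmx0 //.
  by apply: contra sX; apply: YX.
have ftf : f^T *m f = 1%:M.
  apply: (@eq_basis_mx _ _ Y) => y yY; rewrite -mulmxA fE // mul1mx.
  rewrite -(enum_rankK_in (YX _ yY) (YX _ yY)) basis_vecE -colE.
  by apply/colP=> b; rewrite !mxE eq_sym.
have gT_ i : g *m ascent_op K s X i =
    (if i \in Des s x then - 1%:M else 0) *m g.
  apply: (@eq_basis_mx _ _ X) => y yX; rewrite -!mulmxA gE //.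
  rewrite ascent_op_vec //; case: (eqVneq y x) => [->|yx].
    case: ifPn => [_|iA]; first by rewrite mulmxN gE // eqxx mulNmx mul1mx.
    have [sX|/basis_vec_notin->] := boolP ((s i * x)%g \in X).
      by rewrite gE // (negPf (up i x iA xX)) raddf0 mul0mx.
    by rewrite mulmx0 mul0mx.
  rewrite raddf0 mulmx0; case: ifPn => [_|iA].
    by rewrite mulmxN gE // (negPf yx) raddf0 oppr0.
  have [sX|/basis_vec_notin->] := boolP ((s i * y)%g \in X).
    by rewrite gE // (negPf (up i y iA yX)) raddf0.
  by rewrite mulmx0.
have opY : hecke_relations (ascent_op K s Y) := hecke_relations_sub ftf fT opX.
rewrite (big_setD1 x) //= addrC -(IHN Y _ opY); last first.
  by move: cX; rewrite (cardsD1 x) xX => -[].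
apply: groth_class_exact; exists f, g; split=> //=.
- by move=> v fv; rewrite -[v]mul1mx -ftf -mulmxA fv mulmx0.
- move=> w; exists (basis_vec K X x *m w).
  by rewrite mulmxA gE // eqxx mul1mx.
move=> v; split=> [gv|[w <-]]; last first.
  rewrite mulmxA; suff -> : g *m f = 0 by rewrite mul0mx.
  apply: (@eq_basis_mx _ _ Y) => y yY; rewrite -mulmxA fE // gE ?YX // mul0mx.
  by move: yY; rewrite !inE => /andP[/negPf-> _]; rewrite raddf0.
exists (f^T *m v); rewrite mulmxA.
(* The left side is the projection that forgets the coordinate at [x]. It fixes the kernel of [g],
   so [f^T *m v] is a preimage of [v]. *)
suff -> : f *m f^T = 1%:M - basis_vec K X x *m g.
  by rewrite mulmxBl mul1mx -mulmxA gv mulmx0 subr0.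
apply: (@eq_basis_mx _ _ X) => y yX; rewrite mulmxBl mul1mx -!mulmxA gE //.
have [->|yx] := eqVneq y x.
  rewrite mulmx1 subrr; suff -> : f^T *m basis_vec K X x = 0 by rewrite mulmx0.
  rewrite -(enum_rankK_in xX xX) basis_vecE -colE.
  apply/colP=> b; rewrite !mxE enum_rankK_in //.
  by have := enum_valP b; rewrite !inE eq_sym => /andP[/negPf->].
have yY : y \in Y by rewrite !inE yx.
rewrite raddf0 mulmx0 subr0 -[in RHS](fE y yY) -(fE y yY).
by rewrite (mulmxA f^T) ftf mul1mx.
Qed.

End ClassOfAscentModule.

Theorem theorem3p5 (R : realType) (n : nat)
    (gT : finGroupType) (s : 'I_n -> gT) (sB : typeB_system s)
    (ch : {additive groth R[i] n -> fseries})
    (chS : forall I : {set 'I_n},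
       ch (groth_class (simple_module R[i] I)) = FB I)
    (X : {set gT}) (acX : ascent_compatible s X) :
  exists opX : hecke_relations (ascent_op R[i] s X),
    ch (groth_class (HModule opX)) = \sum_(x in X) FB (Des s x).
Proof.
exists (ascent_op_relations R[i] sB acX).
rewrite (groth_class_ascent sB) raddf_sum.
by apply: eq_bigr => x _; apply: chS.
Qed.
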